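(* Let $\mathsf R$ be a multivariate Ore extension of a domain $R$. Fix one of the four settings left, right, bilateral, restricted, and let $F\subset\mathsf R^m\setminus\{0\}$ be a weak (resp. strong) Gröbner basis of $\mathsf I:=\mathbb I(F)$ in that setting. Then: (1) Let $f\in\mathsf R^m\setminus\{0\}$ and let $g\in\mathsf R^m$ be a weak (resp. strong) normal form of $f$ w.r.t. $F$. If $g\ne0$, then $\mathbf T(g)=\min\{\mathbf T(h):h-f\in\mathbb I(F)\}$. (2) Let $f,f'\in\mathsf R^m\setminus\mathsf I$ be such that $f-f'\in\mathsf I$, let $g$ be a weak (resp. strong) normal form of $f$ w.r.t. $F$ and $g'$ a weak (resp. strong) normal form of $f'$ w.r.t. $F$. Then $\mathbf T(g)=\mathbf T(g')=:\tau$ and $\mathrm{lc}(g)-\mathrm{lc}(g')\in\mathsf I_\tau:=\{\mathrm{lc}(p):p\in\mathsf I,\ \mathbf T(p)=\tau\}\cup\{0\}\subset R$.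
   Context: **Ore extensions.** $R$ is a (not necessarily commutative) domain with identity. A multivariate Ore extension $\mathsf R=R[Y_1;\alpha_1,\delta_1]\cdots[Y_n;\alpha_n,\delta_n]$ is an iterated Ore extension ($Y_i\star r=\alpha_i(r)Y_i+\delta_i(r)$, $\alpha_i$ an injective ring endomorphism mapping $R$ to $R$, $\delta_i$ an $\alpha_i$-derivation mapping $R$ to $R$, i.e. additive with $\delta_i(rr')=\alpha_i(r)\delta_i(r')+\delta_i(r)r'$) such that $\alpha_j\delta_i=\delta_i\alpha_j$ for $i\ne j$, $\alpha_i\alpha_j=\alpha_j\alpha_i$, $\delta_i\delta_j=\delta_j\delta_i$, and $\alpha_j(Y_i)=Y_i$, $\delta_j(Y_i)=0$ for $i<j$. Its multiplication is $\star$. It is a free left $R$-module on the terms $\mathcal T=\{Y_1^{a_1}\cdots Y_n^{a_n}\}$, a commutative monoid with product $\circ$. For $\tau=Y_1^{a_1}\cdots Y_n^{a_n}$, $\alpha_\tau=\alpha_1^{a_1}\cdots\alpha_n^{a_n}$. The associated graded ring has the same left $R$-module with product $(a\tau)\ast(b\omega)=a\alpha_\tau(b)\,\tau\circ\omega$. **Orderings.** $\mathsf R^m$ has canonical basis $\mathbf e_i$ (with $r\star(s\mathbf e_i)\star t=(r\star s\star t)\mathbf e_i$) and terms $\mathcal T^{(m)}=\{t\mathbf e_i\}$. Fix a term ordering $\prec$ on $\mathcal T$ and a compatible term ordering $<$ on $\mathcal T^{(m)}$: a well-ordering with $\omega_1\prec\omega_2\Rightarrow\omega_1t<\omega_2t$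 and $t_1<t_2\Rightarrow\omega t_1<\omega t_2$. For $f\neq0$, $\mathbf T(f)$, $\mathrm{lc}(f)$, $\mathbf M(f)=\mathrm{lc}(f)\mathbf T(f)$: maximal term, leading coefficient, maximal monomial. **The four settings.** Consider products $a\lambda\star g\star b\rho$ with $a,b\in R\setminus\{0\}$, $\lambda,\rho\in\mathcal T$, $g\in F$. Bilateral: all are allowed; left: $b=1,\rho=1$; right: $a=1,\lambda=1$; restricted: $\lambda=1,b=1$ (products $a\,g\star\rho$). $\mathbb I(F)$ is the set of all finite sums of allowed products. In each setting, with only allowed products: - weak Gröbner representation of $f$: $f=\sum_ia_i\lambda_i\star g_i\star b_i\rho_i$ with $\lambda_i\circ\mathbf T(g_i)\circ\rho_i\le\mathbf T(f)$ for all $i$; strong Gröbner representation: $f=\sum_ia_i\lambda_i\star g_i\star b_i\rho_i$ with $\mathbf T(f)=\lambda_1\circ\mathbf T(g_1)\circ\rho_1>\lambda_i\circ\mathbf T(g_i)\circ\rho_i$ for all $i>1$ (zero has the empty representation); - $\mathbf M(F)$: the set of all monomials $a\lambda\ast\mathbf M(g)\ast b\rho$ (allowed $a,\lambda,b,\rho$; $g\in F$); $\mathbf M\{\mathbb I(\mathbf M\{F\})\}$: the set of all monomials $ct$ ($c\in R\setminus\{0\},t\in\mathcal T^{(m)}$) which are finite sums of elements of $\mathbf M(F)$ having term $t$; - $F$ is a strong Gröbner basis of $\mathbb I(F)$ if $\mathbf M(f)\in\mathbf M(F)$ for all $f\in\mathbb I(F)\setminus\{0\}$; a weak Gröbner basis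 if $\mathbf M(f)\in\mathbf M\{\mathbb I(\mathbf M\{F\})\}$ for all such $f$; - $h\in\mathsf R^m$ is a weak normal form of $f$ w.r.t. $F$ if $f-h\in\mathbb I(F)$ has a weak Gröbner representation in terms of $F$ and $h\ne0\Rightarrow\mathbf M(h)\notin\mathbf M\{\mathbb I(\mathbf M\{F\})\}$; a strong normal form if $f-h\in\mathbb I(F)$ has a strong Gröbner representation in terms of $F$ and $h\ne0\Rightarrow\mathbf M(h)\notin\mathbf M(F)$. *)

(* Defs.v *)
From HB Require Import structures.
From mathcomp Require Import all_boot all_order all_algebra.
From mathcomp Require Import ssrcomplements.
From mathcomp Require Export mpoly.

Set Implicit Arguments.
Unset Strict Implicit.
Unset Printing Implicit Defensive.

Import GRing.Theory.
Local Open Scope ring_scope.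

(* Every alpha_i, delta_i with i > 1 acts on R[Y_1]...[Y_(i-1)], but as it maps
   R to R, alpha_i(Y_j) = Y_j and delta_i(Y_j) = 0 for j < i, it is the
   coefficientwise extension of its restriction to R; the latter is what is
   recorded here. *)
Record oreData (R : nzRingType) (n : nat) := OreData {
  alpha : 'I_n -> {rmorphism R -> R};
  delta : 'I_n -> {additive R -> R};
  alpha_inj : forall i, injective (alpha i);
  deltaM : forall i r s,
    delta i (r * s) = alpha i r * delta i s + delta i r * s;
  alphaC : forall i j r, alpha i (alpha j r) = alpha j (alpha i r);
  deltaC : forall i j r, delta i (delta j r) = delta j (delta i r);
  alpha_deltaC : forall i j, i != j ->
    forall r, alpha j (delta i r) = delta i (alpha j r)
}.

(* R[Y_1; alpha_1, delta_1]...[Y_n; alpha_n, delta_n]: the free left R-module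
   on the terms, its product being omul below and not that of {mpoly R[n]}. *)
Definition ore (R : nzRingType) (n : nat) (D : oreData R n) : Type :=
  {mpoly R[n]}.

Section OreExtension.
Variables (R : nzRingType) (n : nat) (D : oreData R n).
Implicit Types (m t : 'X_{1..n}) (c r : R) (p q h : {mpoly R[n]}).

(* Left multiplication by Y_i:
     sum c t |-> sum (alpha_i(c) Y_i t + delta_i(c) t).
   The products of {mpoly R[n]}, where variables are central, only serve to
   write this formula. *)
Definition lmulY (i : 'I_n) (p : {mpoly R[n]}) : {mpoly R[n]} :=
  'X_i * map_mpoly (alpha D i) p + map_mpoly (delta D i) p.

(* Left multiplication by the term t = Y_1^(t 1) ... Y_n^(t n). *)
Definition lmult (t : 'X_{1..n}) (p : {mpoly R[n]}) : {mpoly R[n]} :=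
  foldr (fun i => iter (t i) (lmulY i)) p (enum 'I_n).

Definition omul (p q : {mpoly R[n]}) : {mpoly R[n]} :=
  \sum_(t <- msupp p) p@_t *: lmult t q.

(* alpha_t = alpha_1^(t 1) ... alpha_n^(t n) *)
Definition alphat (t : 'X_{1..n}) (r : R) : R :=
  foldr (fun i => iter (t i) (alpha D i)) r (enum 'I_n).

(* The product of the associated graded ring. *)
Definition gmul (p q : {mpoly R[n]}) : {mpoly R[n]} :=
  \sum_(t <- msupp p) \sum_(w <- msupp q)
    (p@_t * alphat t q@_w) *: 'X_[t + w].

Let mapZX (f : {additive R -> R}) c t :
  map_mpoly f (c *: 'X_[t] : {mpoly R[n]}) = f c *: 'X_[t].
Proof.
apply/mpolyP=> k; rewrite mcoeff_map_mpoly !mcoeffZ !mcoeffX.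
by case: eqP; rewrite ?mulr1 ?mulr0 ?raddf0.
Qed.

Fact lmulYD i : {morph lmulY i : p q / p + q}.
Proof. by move=> p q; rewrite /lmulY !raddfD /= mulrDr addrACA. Qed.

Fact lmulYX i c t :
  lmulY i (c *: 'X_[t]) =
    alpha D i c *: 'X_[t + U_(i)] + delta D i c *: 'X_[t].
Proof. rewrite /lmulY !mapZX -mul_mpolyC mulrA -commr_mpolyX -mulrA -mpolyXD.
by rewrite mul_mpolyC addmC. Qed.

Let morph0 (V W : zmodType) (f : V -> W) :
  {morph f : p q / p + q} -> f 0 = 0.
Proof. by move=> fD; apply: (addIr (f 0)); rewrite -fD !add0r. Qed.

Let eq_morph (W : zmodType) (f g : {mpoly R[n]} -> W) :
    {morph f : p q / p + q} -> {morph g : p q / p + q} ->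
  (forall c t, f (c *: 'X_[t]) = g (c *: 'X_[t])) -> f =1 g.
Proof.
move=> fD gD fg p; rewrite [p]mpolyE.
rewrite (big_morph f fD (morph0 fD)) (big_morph g gD (morph0 gD)).
by apply: eq_bigr => t _; apply: fg.
Qed.

Fact lmultD t : {morph lmult t : p q / p + q}.
Proof.
rewrite /lmult => p q; elim: (enum _) => //= i s ->.
by elim: (t i) => //= k ->; rewrite lmulYD.
Qed.

Let omulE p q k : (msize p <= k)%N ->
  omul p q = \sum_(t : 'X_{1..n < k}) p@_t *: lmult t q.
Proof.
move=> le_pk; set I : subFinType _ := 'X_{1..n < k}.
rewrite /omul (big_mksub I) ?msupp_uniq //=; last first.
  by move=> x /msize_mdeg_lt /leq_trans; apply.
by rewrite big_rmcond //= => j /memN_msupp_eq0 ->; rewrite scale0r.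
Qed.

Fact omulDl : left_distributive omul +%R.
Proof.
move=> p q h; set k := maxn (msize (p + q)) (maxn (msize p) (msize q)).
rewrite !(@omulE _ _ k) ?leq_max ?leqnn ?orbT // -big_split /=.
by apply: eq_bigr => t _; rewrite mcoeffD scalerDl.
Qed.

Fact omulDr : right_distributive omul +%R.
Proof.
move=> p q h; rewrite /omul -big_split /=.
by apply: eq_bigr => t _; rewrite lmultD scalerDr.
Qed.

Fact omulX c t p : omul (c *: 'X_[t]) p = c *: lmult t p.
Proof.
case: (eqVneq c 0) => [->|c0].
  by rewrite /omul !scale0r msupp0 big_nil.
rewrite /omul msuppMCX // big_seq1.
by rewrite mcoeffZ mcoeffX eqxx mulr1.
Qed.

Fact lmulYZ i c p : lmulY i (c *: p) = alpha D i c *: lmulY i p + delta D i c *: p.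
Proof.
move: p; apply: eq_morph => [p q|p q|r t].
- by rewrite scalerDr lmulYD.
- by rewrite lmulYD !scalerDr addrACA.
by rewrite scalerA !lmulYX rmorphM deltaM scalerDr scalerDl !scalerA addrA.
Qed.

Fact lmulYC i j p : lmulY i (lmulY j p) = lmulY j (lmulY i p).
Proof.
have [->//|ij] := eqVneq i j.
move: p; apply: eq_morph => [p q|p q|c t]; [by rewrite !lmulYD|by rewrite !lmulYD|].
rewrite !lmulYX !lmulYD !lmulYX (alphaC _ i) (deltaC _ i).
rewrite (alpha_deltaC D ij) -(@alpha_deltaC _ _ D j i) 1?eq_sym //.
by rewrite addrACA -addmA (addmC U_(j)%MM) addmA.
Qed.

Fact lmultDU t i p : lmult (t + U_(i)) p = lmulY i (lmult t p).
Proof.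
pose L u s := foldr (fun i => iter (u i) (lmulY i)) p s.
have LE s : L (t + U_(i))%MM s = iter (count_mem i s) (lmulY i) (L t s).
  elim: s => //= j s ->; rewrite mnmDE mnm1E.
  have C a b x : iter a (lmulY j) (iter b (lmulY i) x)
                 = iter b (lmulY i) (iter a (lmulY j) x).
    elim: a => //= a ->; elim: b => //= b IH.
    by rewrite -[in RHS]IH lmulYC.
  rewrite [i == j]eq_sym; case: eqVneq C => [->|_] C /=; last by rewrite addn0 C.
  by rewrite addn1 -[in RHS]C.
rewrite /lmult -/(L _ _) LE count_uniq_mem ?enum_uniq //.
by rewrite mem_enum.
Qed.

Fact lmult0 p : lmult 0 p = p.
Proof. by rewrite /lmult; elim: (enum _) => //= i s ->; rewrite mnm0E. Qed.

Fact lmult_add t w p : lmult t (lmult w p) = lmult (t + w) p.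
Proof.
rewrite [t]multinomUE_id.
elim/big_rec: _ => [|i u _ IH]; first by rewrite add0m lmult0.
elim: (t i) => [|k IHk]; first by rewrite mulm0n !add0m.
have SE v : (U_(i) *+ k.+1 + v = U_(i) *+ k + v + U_(i))%MM.
  by rewrite mulmSr -!addmA (addmC v).
by rewrite -[in RHS]addmA !SE !lmultDU IHk addmA.
Qed.

Fact omul_lmulY i p q : omul (lmulY i p) q = lmulY i (omul p q).
Proof.
move: p; apply: eq_morph => [p h|p h|c t].
- by rewrite lmulYD omulDl.
- by rewrite omulDl lmulYD.
by rewrite lmulYX omulDl !omulX lmulYZ lmultDU.
Qed.

Fact omul_lmult t p q : omul (lmult t p) q = lmult t (omul p q).
Proof.
rewrite /lmult; elim: (enum _) => //= i s <-.
by elim: (t i) => //= k <-; rewrite omul_lmulY.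
Qed.

Fact omulZl c p q : omul (c *: p) q = c *: omul p q.
Proof.
move: p; apply: eq_morph => [p h|p h|r t].
- by rewrite scalerDr omulDl.
- by rewrite omulDl scalerDr.
by rewrite scalerA !omulX scalerA.
Qed.

Fact omulA : associative omul.
Proof.
move=> p q h; move: p; apply: eq_morph => [p p'|p p'|c t].
- by rewrite omulDl.
- by rewrite !omulDl.
by rewrite !omulX omulZl omul_lmult.
Qed.

Fact delta1 i : delta D i 1 = 0.
Proof.
have := deltaM D i 1 1; rewrite !mulr1 rmorph1 mul1r => /esym/eqP.
by rewrite -subr_eq0 addrK => /eqP.
Qed.

Fact lmult1 t : lmult t 1 = 'X_[t].
Proof.
have LE s : foldr (fun i => iter (t i) (lmulY i)) 1 s
            = 'X_[\sum_(i <- s) (U_(i) *+ t i)].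
  elim: s => [|i s /= ->]; first by rewrite big_nil mpolyX0.
  rewrite big_cons addmC; move: (\big[_/_]_(_ <- _) _)%MM => u.
  elim: (t i) => [|k /= ->]; first by rewrite mulm0n addm0.
  rewrite -[X in lmulY i X]scale1r lmulYX rmorph1 delta1 scale0r addr0 scale1r.
  by rewrite mulmSr addmA.
by rewrite /lmult LE big_enum -multinomUE_id.
Qed.

Fact omul1l : left_id 1 omul.
Proof. by move=> p; rewrite -mpolyX0 -[X in omul X]scale1r omulX scale1r lmult0. Qed.

Fact omul1r : right_id 1 omul.
Proof.
move=> p; move: p; apply: eq_morph => [p q|p q|c t] //; first exact: omulDl.
by rewrite omulX lmult1.
Qed.

HB.instance Definition _ := GRing.Lmodule.copy (ore D) {mpoly R[n]}.
HB.instance Definition _ := GRing.Zmodule_isNzRing.Build (ore D)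
  omulA omul1l omul1r omulDl omulDr (oner_neq0 {mpoly R[n]}).

Definition oremono (c : R) (t : 'X_{1..n}) : ore D := c *: 'X_[t].

End OreExtension.

Fact ore_YR R n (D : oreData R n) i r :
  oremono D 1 U_(i)%MM * oremono D r 0%MM =
    oremono D (alpha D i r) U_(i)%MM + oremono D (delta D i r) 0%MM.
Proof.
rewrite {1 2}/oremono [LHS]omulX scale1r -[U_(i)%MM]add0m lmultDU lmult0.
by rewrite lmulYX.
Qed.

Fact ore_mulX R n (D : oreData R n) c (t w : 'X_{1..n}) :
  oremono D c t * oremono D 1 w = oremono D c (t + w)%MM.
Proof.
rewrite {1 2}/oremono [LHS]omulX scale1r -(lmult1 D w).
by rewrite lmult_add lmult1.
Qed.

Fact gmulX R n (D : oreData R n) a b (t w : 'X_{1..n}) :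
  gmul D (oremono D a t) (oremono D b w) = oremono D (a * alphat D t b) (t + w)%MM.
Proof.
rewrite /gmul /oremono.
have [->|a0] := eqVneq a 0; first by rewrite mul0r !scale0r msupp0 big_nil.
rewrite msuppMCX // big_seq1 mcoeffZ mcoeffX eqxx mulr1.
have [->|b0] := eqVneq b 0; last first.
  by rewrite msuppMCX // big_seq1 mcoeffZ mcoeffX eqxx mulr1.
rewrite scale0r msupp0 big_nil (_ : alphat D t 0 = 0) ?mulr0 ?scale0r //.
rewrite /alphat; elim: (enum _) => //= i s ->.
by elim: (t i) => //= k ->; rewrite rmorph0.
Qed.

Definition well_ordering (T : eqType) (lt : rel T) : Prop :=
  [/\ irreflexive lt, transitive lt, forall x y, x != y -> lt x y || lt y x
    & forall P : T -> Prop, (exists x, P x) ->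
        exists2 x, P x & forall y, P y -> (x == y) || lt x y].

(* (t, i) stands for the term t e_i. *)
Definition mterm (n m : nat) : Type := ('X_{1..n} * 'I_m)%type.

(* w t r for terms w, r of the ring and a term t of the module *)
Definition tmul n m (w : 'X_{1..n}) (t : mterm n m) (r : 'X_{1..n}) : mterm n m :=
  ((w + t.1 + r)%MM, t.2).

Definition term_ordering n (prec : rel 'X_{1..n}) : Prop :=
  well_ordering prec /\
  forall w w1 w2, prec w1 w2 -> prec (w + w1)%MM (w + w2)%MM.

Definition mterm_ordering n m (prec : rel 'X_{1..n}) (lt : rel (mterm n m)) : Prop :=
  [/\ well_ordering lt,
      forall w1 w2 t, prec w1 w2 -> lt (tmul w1 t 0%MM) (tmul w2 t 0%MM)
    & forall w t1 t2, lt t1 t2 -> lt (tmul w t1 0%MM) (tmul w t2 0%MM)].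

(* A strict ordering of the terms extended to option, with None, which plays
   the role of T(0), below every term. *)
Definition ole (T : eqType) (lt : rel T) (x y : option T) : bool :=
  match x, y with
  | None, _ => true
  | Some _, None => false
  | Some t, Some u => (t == u) || lt t u
  end.

Definition olt (T : eqType) (lt : rel T) (x y : option T) : bool :=
  (x != y) && ole lt x y.

Definition is_min (X : Type) (le : rel X) (A : X -> Prop) (x : X) : Prop :=
  A x /\ forall y, A y -> le x y.

Inductive setting := Left | Right | Bilateral | Restricted.

Inductive strength := Weak | Strong.

Section Module.
Variables (R : nzRingType) (n : nat) (D : oreData R n) (m : nat).
Variable lt : rel (mterm n m).

Local Notation S := (ore D).
Local Notation V := 'rV[ore D]_m.

Definition bact (p : S) (f : V) (q : S) : V := \row_i (p * f 0 i * q).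

(* the analogue of bact in the associated graded ring *)
Definition gact (p : S) (f : V) (q : S) : V :=
  \row_i (gmul D (gmul D p (f 0 i)) q).

Definition vmono (c : R) (t : mterm n m) : V :=
  \row_i (if i == t.2 then oremono D c t.1 else 0).

Definition vcoef (f : V) (t : mterm n m) : R := mcoeff t.1 (f 0 t.2).

Definition vsupp (f : V) : seq (mterm n m) :=
  [seq (t, i) | i <- enum 'I_m, t <- msupp (f 0 i)].

(* T(f), as Some t; None when f = 0. *)
Definition lterm (f : V) : option (mterm n m) :=
  ohead [seq t <- vsupp f | all (fun u => (u == t) || lt u t) (vsupp f)].

(* With the harmless convention lc(0) = 0. *)
Definition lc (f : V) : R := if lterm f is Some t then vcoef f t else 0.

Definition lmono (f : V) : V := if lterm f is Some t then vmono (lc f) t else 0.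

(* The data of a product a l * g * b r. *)
Record product := Product {
  pa : R; pl : 'X_{1..n}; pg : V; pb : R; pr : 'X_{1..n} }.

Definition allowed (s : setting) (F : V -> Prop) (x : product) : Prop :=
  [/\ pa x != 0, pb x != 0, F (pg x)
    & match s with
      | Left => pb x = 1 /\ pr x = 0%MM
      | Right => pa x = 1 /\ pl x = 0%MM
      | Bilateral => True
      | Restricted => pl x = 0%MM /\ pb x = 1
      end].

Definition pval (x : product) : V :=
  bact (oremono D (pa x) (pl x)) (pg x) (oremono D (pb x) (pr x)).

(* l o T(g) o r *)
Definition pterm (x : product) : option (mterm n m) :=
  omap (fun t => tmul (pl x) t (pr x)) (lterm (pg x)).

(* a l * M(g) * b r in the associated graded ring *)
Definition pmono (x : product) : V :=
  gact (oremono D (pa x) (pl x)) (lmono (pg x)) (oremono D (pb x) (pr x)).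

Definition ideal s F (f : V) : Prop :=
  exists k (x : 'I_k -> product),
    (forall i, allowed s F (x i)) /\ f = \sum_(i < k) pval (x i).

Definition weak_representation s F (f : V) : Prop :=
  exists k (x : 'I_k -> product),
    [/\ forall i, allowed s F (x i), f = \sum_(i < k) pval (x i)
      & forall i, ole lt (pterm (x i)) (lterm f)].

Definition strong_representation s F (f : V) : Prop :=
  f = 0 \/
  exists k (x : 'I_k.+1 -> product),
    [/\ forall i, allowed s F (x i), f = \sum_(i < k.+1) pval (x i),
        lterm f = pterm (x ord0)
      & forall i, i != ord0 -> olt lt (pterm (x i)) (pterm (x ord0))].

Definition representation (k : strength) s F : V -> Prop :=
  match k with
  | Weak => weak_representation s F
  | Strong => strong_representation s F
  end.

Definition monomials s F (u : V) : Prop :=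
  exists2 x, allowed s F x & u = pmono x.

(* M{I(M{F})}: the summands all have the term of u. *)
Definition sum_monomials s F (u : V) : Prop :=
  exists c t, [/\ c != 0, u = vmono c t &
    exists k (v : 'I_k -> V),
      (forall i, monomials s F (v i) /\ lterm (v i) = Some t) /\
      u = \sum_(i < k) v i].

Definition leading_monomials (k : strength) s F : V -> Prop :=
  match k with
  | Weak => sum_monomials s F
  | Strong => monomials s F
  end.

Definition groebner_basis (k : strength) s F : Prop :=
  forall f, ideal s F f -> f != 0 -> leading_monomials k s F (lmono f).

Definition normal_form (k : strength) s F (f h : V) : Prop :=
  [/\ ideal s F (f - h), representation k s F (f - h)
    & h != 0 -> ~ leading_monomials k s F (lmono h)].

Definition lc_ideal (I : V -> Prop) (t : mterm n m) (c : R) : Prop :=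
  (exists p, [/\ I p, lterm p = Some t & c = lc p]) \/ c = 0.

End Module.

(* Main.v *)
(* If h is congruent to the normal form g modulo the ideal and T(h) < T(g), then
   g - h lies in the ideal and has the maximal monomial of g, which the Groebner
   basis property forbids.  Hence T(g) is minimal in its class, so the normal
   forms of congruent elements share their term, and the leading coefficient of
   their difference is the difference of their leading coefficients unless the
   latter vanishes. *)
Require Import Defs.
From mathcomp Require Import all_boot all_order all_algebra.

Set Implicit Arguments.
Unset Strict Implicit.
Unset Printing Implicit Defensive.

Import GRing.Theory.
Local Open Scope ring_scope.

(** * Leading terms and leading coefficients of differences *)

Section LeadingTerm.
Variables (R : nzRingType) (n m : nat) (D : oreData R n).
Variables (lt : rel (mterm n m)) (lt_wo : well_ordering lt).
Implicit Types (f g h : 'rV[ore D]_m) (t u : mterm n m).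

Local Notation T := (lterm lt).

Let lt_irr : irreflexive lt. Proof. by case: lt_wo. Qed.
Let lt_trans : transitive lt. Proof. by case: lt_wo. Qed.
Let lt_total t u : t != u -> lt t u || lt u t.
Proof. by case: lt_wo => _ _ tot _; apply: tot. Qed.

Lemma vcoefB f g t : vcoef (f - g) t = vcoef f t - vcoef g t.
Proof. by rewrite /vcoef !mxE; apply: mcoeffB. Qed.

Lemma vcoef0 t : vcoef (0 : 'rV[ore D]_m) t = 0.
Proof. by rewrite /vcoef mxE; apply: mcoeff0. Qed.

Lemma mem_vsupp f t : (t \in vsupp f) = (vcoef f t != 0).
Proof.
rewrite /vcoef -mcoeff_msupp; apply/allpairsPdep/idP => [[i [w [_ wf ->]]] //|tf].
by exists t.2, t.1; rewrite mem_enum; split=> //; case: (t).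
Qed.

(** Induction on the list compares the head with the maximum of the tail. *)
Lemma vsupp_max (s : seq (mterm n m)) : s != [::] ->
  exists2 t, t \in s & all (fun u => (u == t) || lt u t) s.
Proof.
elim: s => // t [|u s] IH _; first by exists t; rewrite ?mem_head //= eqxx.
have [//|v vs /allP max_v] := IH.
have [tv|] := boolP ((t == v) || lt t v).
  exists v; first by rewrite in_cons vs orbT.
  rewrite -/(all _ (u :: s)); apply/allP=> w.
  by rewrite in_cons => /orP[/eqP->|/max_v].
rewrite negb_or => /andP[/lt_total]; case/orP=> [-> //|vt _].
exists t; first exact: mem_head.
apply/allP=> w; rewrite in_cons => /orP[-> //|/max_v /orP[/eqP->|wv]].
  by rewrite vt orbT.
by rewrite (lt_trans wv vt) orbT.
Qed.

Lemma lterm_mem f t : T f = Some t ->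
  t \in vsupp f /\ all (fun u => (u == t) || lt u t) (vsupp f).
Proof.
rewrite /lterm; case E: [seq _ <- _ | _] => [//|u s] [<-].
by have := mem_head u s; rewrite -E mem_filter => /andP[].
Qed.

Lemma lterm_exists f : vsupp f != [::] -> exists t, T f = Some t.
Proof.
move=> /vsupp_max [t tf max_t]; rewrite /lterm; case E: [seq _ <- _ | _] => [|u s].
  by have := in_nil t; rewrite -E mem_filter max_t tf.
by exists u.
Qed.

(** Trades the list computation in [lterm] for conditions on coefficients, which [vcoefB] carries
    over to differences. *)
Lemma ltermP f t :
  T f = Some t <-> vcoef f t != 0 /\ forall u, lt t u -> vcoef f u = 0.
Proof.
split=> [/lterm_mem [tf /allP max_t]|[tf above]].
  split=> [|u tu]; first by rewrite -mem_vsupp.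
  apply/eqP; apply: contraFT (lt_irr t); rewrite -mem_vsupp => /max_t.
  by case/orP=> [/eqP eq_ut|/(lt_trans tu)//]; rewrite eq_ut in tu.
move: tf; rewrite -mem_vsupp => tf.
(* Some leading term u exists, and t < u would make the coefficient of f at u vanish. *)
have [|u Tu] := @lterm_exists f; first by apply: contraTneq tf => ->.
rewrite Tu; congr Some; have [uf /allP max_u] := lterm_mem Tu.
case/orP: (max_u t tf) => [/eqP-> //|/above u0].
by move: uf; rewrite mem_vsupp u0 eqxx.
Qed.

Lemma ltermN0 f : f != 0 -> exists t, T f = Some t.
Proof.
move=> f0; apply: lterm_exists; apply: contraNneq f0 => s0.
apply/eqP/rowP=> i; rewrite mxE; apply/mpolyP=> w; rewrite mcoeff0.
by apply/eqP; have := mem_vsupp f (w, i); rewrite s0 in_nil => /esym/negbFE.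
Qed.

Lemma lterm0 : T (0 : 'rV[ore D]_m) = None.
Proof.
by case E: (T 0) => [t|//]; case/ltermP: E; rewrite vcoef0 eqxx.
Qed.

(** Comparing in the option order covers f = 0 too, since [None] lies below every term. *)
Lemma vcoef_ge f t u : olt lt (T f) (Some t) -> (t == u) || lt t u ->
  vcoef f u = 0.
Proof.
case E: (T f) => [v|] /andP[vt] /=; last first.
  by move=> _ _; have [->|/ltermN0 [w]] := eqVneq f 0; rewrite ?vcoef0 ?E.
rewrite (inj_eq Some_inj) in vt; rewrite (negPf vt) /= => {}vt tu.
have [_] := (ltermP f v).1 E; apply.
by case/orP: tu => [/eqP<-//|]; apply: lt_trans.
Qed.

(** The coefficients of g vanish at t and above, so those of f survive there. *)
Lemma ltermB f g t : T f = Some t -> olt lt (T g) (Some t) -> T (f - g) = Some t.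
Proof.
move=> /ltermP [tf above] gt; apply/ltermP; split=> [|u tu].
  by rewrite vcoefB (vcoef_ge gt) ?eqxx // subr0.
by rewrite vcoefB above // (vcoef_ge gt) ?tu ?orbT // subr0.
Qed.

Lemma lmonoB f g t : T f = Some t -> olt lt (T g) (Some t) ->
  lmono lt (f - g) = lmono lt f.
Proof.
move=> Tf gt; rewrite /lmono /lc (ltermB Tf gt) Tf vcoefB.
by rewrite (vcoef_ge gt) ?eqxx // subr0.
Qed.

(** Distinct leading coefficients do not cancel at t, and above t both elements have zero
    coefficients. *)
Lemma ltermB_eq f g t : T f = Some t -> T g = Some t ->
  lc lt f != lc lt g -> T (f - g) = Some t /\ lc lt (f - g) = lc lt f - lc lt g.
Proof.
move=> Tf Tg; rewrite /lc Tf Tg => fg.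
have TB : T (f - g) = Some t.
  have [_ f0] := (ltermP f t).1 Tf; have [_ g0] := (ltermP g t).1 Tg.
  apply/ltermP; split=> [|u tu]; first by rewrite vcoefB subr_eq0.
  by rewrite vcoefB f0 // g0 // subr0.
by rewrite TB vcoefB.
Qed.

Lemma ole_anti (x y : option (mterm n m)) : ole lt x y -> ole lt y x -> x = y.
Proof.
case: x y => [t|] [u|] //= /orP[/eqP-> //|tu] /orP[/eqP-> //|ut].
by have := lt_irr t; rewrite (lt_trans tu ut).
Qed.

Lemma oltNge (x y : option (mterm n m)) : ~~ ole lt x y -> olt lt y x.
Proof.
case: x y => [t|] [u|] //=; rewrite negb_or /olt (inj_eq Some_inj) eq_sym.
by case/andP=> /[dup] tu /lt_total /=; rewrite tu orbC => /orP[->|->]; rewrite ?orbT.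
Qed.

End LeadingTerm.

(** * Congruence modulo the ideal *)

Section Ideal.
Variables (R : nzRingType) (n m : nat) (D : oreData R n).
Variables (s : setting) (F : 'rV[ore D]_m -> Prop).
Implicit Types f g : 'rV[ore D]_m.

Lemma ideal0 : ideal s F 0.
Proof.
exists 0, (fun i : 'I_0 => match notF (ltn_ord i) with end).
by split=> [[]|]; rewrite ?big_ord0.
Qed.

(** The two families of products are concatenated. *)
Lemma idealD f g : ideal s F f -> ideal s F g -> ideal s F (f + g).
Proof.
move=> [k [x [Fx ->]]] [l [y [Fy ->]]].
exists (k + l)%N, (fun i => match split i with inl j => x j | inr j => y j end).
split=> [i|]; first by case: (split i).
by rewrite big_split_ord; congr (_ + _); apply: eq_bigr => i _;
  rewrite ?(unsplitK (inl i)) ?(unsplitK (inr i)).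
Qed.

(* The sign goes to whichever coefficient the setting leaves free. *)
Lemma allowedN (x : product D m) : allowed s F x ->
  exists2 y, allowed s F y & pval y = - pval x.
Proof.
case: x => a l g b r [/= a0 b0 Fg sx].
have oremonoN c t : oremono D (- c) t = - oremono D c t by apply: scaleNr.
have Na : pval (Product (- a) l g b r) = - pval (Product a l g b r).
  by apply/rowP=> i; rewrite !mxE oremonoN !mulNr.
have Nb : pval (Product a l g (- b) r) = - pval (Product a l g b r).
  by apply/rowP=> i; rewrite !mxE oremonoN mulrN.
case: s sx => sx; try
  by exists (Product (- a) l g b r) => //; split=> //=; rewrite oppr_eq0.
by exists (Product a l g (- b) r) => //; split=> //=; rewrite oppr_eq0.
Qed.

(** [allowedN] only asserts that a negated product exists, so induction on the number of products
    picks them one at a time. *)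
Lemma idealN f : ideal s F f -> ideal s F (- f).
Proof.
move=> [k [x [Fx ->]]]; elim: k x Fx => [|k IH] x Fx.
  by rewrite big_ord0 oppr0; apply: ideal0.
rewrite big_ord_recl opprD; apply: idealD; last by apply: IH.
have [y Fy <-] := allowedN (Fx ord0).
by exists 1, (fun=> y); split=> //; rewrite big_ord1.
Qed.

Lemma idealBC f g : ideal s F (f - g) -> ideal s F (g - f).
Proof. by move/idealN; rewrite opprB. Qed.

Lemma idealB_trans g f h :
  ideal s F (f - g) -> ideal s F (g - h) -> ideal s F (f - h).
Proof. by move=> fg /(idealD fg); rewrite addrA subrK. Qed.

End Ideal.

(** * Minimality of normal forms and comparison of congruent ones *)

Theorem proposition20 (R : nzRingType) (domR : GRing.integral_domain_axiom R)
    (n m : nat) (D : oreData R n)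
    (prec : rel 'X_{1..n}) (lt : rel (mterm n m))
    (prec_to : term_ordering prec) (lt_to : mterm_ordering prec lt)
    (s : setting) (k : strength)
    (F : 'rV[ore D]_m -> Prop) (F_neq0 : forall g, F g -> g != 0)
    (F_gb : groebner_basis lt k s F) :
  (forall f g : 'rV[ore D]_m, f != 0 -> normal_form lt k s F f g -> g != 0 ->
     is_min (ole lt)
       (fun t => exists2 h, ideal s F (h - f) & t = lterm lt h) (lterm lt g))
  /\
  (forall f f' g g' : 'rV[ore D]_m,
     ~ ideal s F f -> ~ ideal s F f' -> ideal s F (f - f') ->
     normal_form lt k s F f g -> normal_form lt k s F f' g' ->
     exists t : mterm n m,
       [/\ lterm lt g = Some t, lterm lt g' = Some t
         & lc_ideal lt (ideal s F) t (lc lt g - lc lt g')]).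
Proof.
have lt_wo : well_ordering lt by case: lt_to.
(* Weak and strong are handled together: [normal_form] and [F_gb] refer to the same
   [leading_monomials lt k s F]. *)
have minT (f g : 'rV[ore D]_m) : normal_form lt k s F f g -> g != 0 ->
    forall h, ideal s F (h - f) -> ole lt (lterm lt g) (lterm lt h).
  move=> [Ifg _ nfg] g0 h Ihf; apply/negPn/negP => /(oltNge lt_wo).
  have [t Tg] := ltermN0 lt_wo g0; rewrite Tg => hg; apply: nfg => //.
  rewrite -(lmonoB lt_wo Tg hg); apply: F_gb.
    (* Here g - h = (g - f) + (f - h). *)
    exact: idealB_trans (idealBC Ifg) (idealBC Ihf).
  (* The difference g - h has leading term t, whereas zero has none. *)
  by apply: contra_eq_neq (ltermB lt_wo Tg hg) => ->; rewrite lterm0.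
split=> [f g _ nf g0|f f' g g' If If' Iff' nf nf'].
  split=> [|_ [h Ihf ->]]; last exact: minT nf g0 h Ihf.
  (* The minimum is attained at g itself. *)
  by exists g => //; case: nf => /idealBC.
have nf_neq0 (p q : 'rV[ore D]_m) : ~ ideal s F p ->
    normal_form lt k s F p q -> q != 0.
  by move=> Ip [Ipq _ _]; apply/eqP=> q0; rewrite q0 subr0 in Ipq.
have [Ifg _ _] := nf; have [Ifg' _ _] := nf'.
have g0 := nf_neq0 _ _ If nf; have g0' := nf_neq0 _ _ If' nf'.
have Tgg' : lterm lt g = lterm lt g'.
  apply: (ole_anti lt_wo).
    (* Through f', the element g' is congruent to f and so competes with g; the other inequality is
       symmetric. *)
    exact: minT nf g0 _ (idealB_trans (idealBC Ifg') (idealBC Iff')).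
  exact: minT nf' g0' _ (idealB_trans (idealBC Ifg) Iff').
have [t Tg] := ltermN0 lt_wo g0; have Tg' := etrans (esym Tgg') Tg.
exists t; split=> //.
(* Equal leading coefficients fall under the zero clause of [lc_ideal]. *)
have [->|lcgg'] := eqVneq (lc lt g) (lc lt g'); first by right; rewrite subrr.
have [TB lcB] := ltermB_eq lt_wo Tg Tg' lcgg'.
(* Membership comes from g - g' = (g - f) + (f - f') + (f' - g'). *)
left; exists (g - g'); split=> //.
exact: idealB_trans (idealBC Ifg) (idealB_trans Iff' Ifg').
Qed.
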